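(* Let $r\ge 3$ and let $\mathcal{H}$ be an $r$-uniform $r$-partite linear hypergraph which contains no rainbow cycles of length three or four. Then $\mathcal{H}$ is $\mathcal{G}_r(7r-11,7)$-free.
   Context: A hypergraph is linear if any two distinct edges share at most one vertex. An $r$-uniform hypergraph is $r$-partite if its vertex set is partitioned into $r$ parts $V_1,\dots,V_r$ such that every edge contains exactly one vertex of each part. A cycle of length $k$ is a sequence $v_1,A_1,\dots,v_k,A_k,v_1$ of distinct vertices and distinct edges with $v_i,v_{i+1}\in A_i$ ($1\le i\le k-1$) and $v_k,v_1\in A_k$; it is a rainbow $k$-cycle if $v_1,\dots,v_k$ lie in pairwise different parts. An $r$-uniform hypergraph is $\mathcal{G}_r(v,e)$-free if the union of any $e$ distinct edges has at least $v+1$ vertices. *)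

(* Defs.v *)
From mathcomp Require Import all_boot.
Set Implicit Arguments.
Unset Strict Implicit.
Unset Printing Implicit Defensive.

Section Hypergraph.
Variables (V : finType) (H : {set {set V}}).

Definition uniform (r : nat) : Prop := forall A, A \in H -> #|A| = r.

Definition linear_hypergraph : Prop :=
  forall A B, A \in H -> B \in H -> A != B -> #|A :&: B| <= 1.

(* A partition of the vertex set into r labelled parts is given by the map
   [part] sending a vertex to the index of its part. *)
Definition partite_by (r : nat) (part : V -> 'I_r) : Prop :=
  forall A (i : 'I_r), A \in H -> #|[set x in A | part x == i]| = 1.

(* [ordS] is the successor modulo k, so the last edge joins the last vertex
   to the first one. *)
Definition is_cycle (k : nat) (v : 'I_k -> V) (A : 'I_k -> {set V}) : Prop :=
  [/\ injective v, injective A, forall i, A i \in H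
    & forall i, v i \in A i /\ v (ordS i) \in A i].

Definition has_rainbow_cycle (r : nat) (part : V -> 'I_r) (k : nat) : Prop :=
  exists v A, @is_cycle k v A /\ injective (fun i => part (v i)).

Definition G_free (v e : nat) : Prop :=
  forall E : {set {set V}}, E \subset H -> #|E| = e -> v.+1 <= #|cover E|.

End Hypergraph.

(* Main.v *)
Require Import Defs.
From mathcomp Require Import all_boot zify.

(** Suppose seven edges cover at most [7 r - 11] vertices. Choosing for every
    covered vertex a root among the edges through it, and joining the root to
    the other edges through that vertex, gives a graph on the seven edges with
    at least 11 adjacencies. Every 3-cycle is rainbow, as two vertices of a
    common edge lie in different parts, so this graph is triangle-free, and
    therefore contains a [K_{2,4}]. Since no 4-cycle is rainbow, a 4-cycle
    [A X B Y] of the graph has two opposite adjacencies realised in the same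
    part. Orienting every pair [X, Y] of the four vertices on one side of the
    [K_{2,4}] accordingly gives a tournament on 4 vertices with all
    outdegrees at most 1, which is impossible. *)

Set Implicit Arguments.
Unset Strict Implicit.
Unset Printing Implicit Defensive.

Lemma card_dep_pairs (S T : finType) (P : pred S) (Q : S -> pred T) :
  #|[set z : S * T | P z.1 && Q z.1 z.2]| = \sum_(x | P x) #|Q x|.
Proof.
rewrite -sum1dep_card -(pair_big_dep P Q (fun _ _ => 1)) /=.
by apply: eq_bigr => x _; rewrite sum1_card.
Qed.

(** * Dense triangle-free graphs on seven vertices *)

Section TriangleFree.
Variables (T : finType) (E : {set T}) (e : rel T).
Hypotheses (cardE : #|E| = 7) (eE : forall x y, e x y -> y \in E).
Hypotheses (esym : symmetric e) (eirr : irreflexive e).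
Hypothesis etri : forall x y z, e x y -> e y z -> e z x -> False.

Let N x := [set y | e x y].

(** A vertex [v] of maximum degree has an independent neighbourhood, so its complement [O] meets
    every edge and carries at least half of the degree sum. This forces degree 4 and
    [O = {v, u, w}], and one of [u], [w] then has the same neighbours as [v]. *)
Lemma triangle_free7_K24 :
  22 <= \sum_(x in E) #|N x| ->
  exists x y, [/\ x \in E, y \in E, x != y & 4 <= #|N x :&: N y|].
Proof.
move=> dE.
have E0 : 0 < #|E| by rewrite cardE.
have [x0 x0E] := card_gt0P E0.
case: (arg_maxnP (fun x => #|N x|) x0E) => v vE vmax.
have NE x : N x \subset E by apply/subsetP => y; rewrite inE; apply: eE.
have d4 : 4 <= #|N v|.
  rewrite leqNgt; apply/negP => dv.
  have : \sum_(x in E) #|N x| <= \sum_(x in E) 3.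
    by apply: leq_sum => x xE; apply: leq_trans (vmax _ xE) _.
  by rewrite sum_nat_const cardE; lia.
pose O := E :\: N v.
have cO : #|O| = 7 - #|N v| by rewrite /O cardsD (setIidPr (NE v)) cardE.
have splitE : \sum_(x in E) #|N x|
    = \sum_(x in N v) #|N x| + \sum_(x in O) #|N x|.
  rewrite (big_setID (N v)) /=; congr (_ + _); apply: eq_bigl => x.
  by rewrite (setIidPr (NE v)).
(* [N v] is independent, so all its edges go to [O]. *)
have leO : \sum_(x in N v) #|N x| <= \sum_(x in O) #|N x|.
  have -> : \sum_(x in N v) #|N x| = \sum_(x in N v) \sum_(y in O | e x y) 1.
    apply: eq_bigr => x; rewrite inE => vx; rewrite -sum1_card.
    apply: eq_bigl => y; rewrite !inE.
    case exy: (e x y); last by rewrite andbF.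
    rewrite (eE exy) !andbT; case vy: (e v y) => //.
    by case: (etri vx exy); rewrite esym.
  rewrite (exchange_big_dep (fun y => y \in O)) /=; last by move=> x y _ /andP[].
  apply: leq_sum => y yO; rewrite sum1dep_card; apply: subset_leq_card.
  by apply/subsetP => x; rewrite !inE [e y x]esym => /andP[_ /andP[]].
have vO : v \in O by rewrite !inE eirr.
have leOd (x : T) : x \in O -> #|N x| <= #|N v|.
  by rewrite inE => /andP[_ /vmax].
have leOd2 : \sum_(x in O) #|N x| <= #|O| * #|N v|.
  by rewrite -sum_nat_const; apply: leq_sum => x /leOd.
have sO : 11 <= \sum_(x in O) #|N x| by move: dE; rewrite splitE; lia.
(* With [d = #|N v|], [11 <= (7 - d) * d] fails for [d = 5, 6, 7], where the product is 10, 6, 0. *)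
have d4E : #|N v| = 4.
  have := leq_trans sO leOd2; rewrite cO.
  have := subset_leq_card (NE v); rewrite cardE; move: (#|N v|) d4 => d.
  by do 8 (case: d => [|d] //).
have cOv : #|O :\ v| = 2 by have := cardsD1 v O; rewrite vO cO d4E; lia.
have /eqP/cards2P[u [w [uw Ouw]]] := cOv.
have OE : O = [set v; u; w] by rewrite -(setD1K vO) Ouw setUA.
have sum3 : 11 <= 4 + #|N u| + #|N w|.
  move: sO; rewrite (big_setD1 v) //= Ouw big_setU1 ?inE //= big_set1 d4E.
  by rewrite addnA.
have K24 a b : O :\ v = [set a; b] -> #|N a| >= 4 -> #|N b| >= 3 ->
    4 <= #|N v :&: N a|.
  move=> Oab da db.
  have inO x : x \in E -> [|| x \in N v, x == v, x == a | x == b].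
    move=> xE; case xv: (x \in N v) => //=; case: eqP => //= /eqP xnv.
    have : x \in O :\ v by rewrite in_setD1 xnv in_setD xv xE.
    by rewrite Oab !inE.
  have nv x : x \in O :\ v -> e x v = false.
    by rewrite !inE => /and3P[_ /negPf]; rewrite esym.
  have nva : e a v = false by apply: nv; rewrite Oab !inE eqxx.
  have nvb : e b v = false by apply: nv; rewrite Oab !inE eqxx orbT.
  have subN c d x : e c v = false -> [|| x \in N v, x == v, x == c | x == d] ->
      x \in N c -> x \in (d |: N v :&: N c).
    move=> cv; rewrite !inE => /or4P[->|/eqP->|/eqP->|->] //.
    - by move=> ->; rewrite orbT.
    - by rewrite cv.
    - by rewrite eirr.
  have sa : N a \subset b |: N v :&: N a.
    by apply/subsetP => x xa; apply: subN => //; apply/inO/(subsetP (NE a)).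
  have sb : N b \subset a |: N v :&: N b.
    apply/subsetP => x xb; apply: subN => //.
    by have := inO x (subsetP (NE b) _ xb); rewrite [(x == a) || _]orbC.
  (* Within [O], the only possible neighbour of [a] is [b], and conversely. If they are adjacent, at
     least 3 neighbours of [a] and 2 of [b] lie in the 4-element set [N v], so they overlap and
     close a triangle. *)
  case eab: (e a b); last first.
    apply: leq_trans da (subset_leq_card _); apply/subsetP => x xa.
    have := subsetP sa x xa; rewrite in_setU1 => /orP[/eqP xb|//].
    by move: xa; rewrite xb inE eab.
  have ca := leq_trans (subset_leq_card sa) (leq_card_setU _ _).
  have cb := leq_trans (subset_leq_card sb) (leq_card_setU _ _).
  rewrite !cards1 in ca cb.
  have := cardsUI (N v :&: N a) (N v :&: N b).
  have : #|N v :&: N a :|: N v :&: N b| <= #|N v|.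
    by rewrite -setIUr subset_leq_card // subsetIl.
  have [->|[x]] := set_0Vmem (N v :&: N a :&: (N v :&: N b)).
    by rewrite cards0; lia.
  rewrite !inE => /andP[/andP[_ ax] /andP[_ bx]] _ _.
  by case: (@etri a b x) => //; rewrite esym.
have Ov x : x \in O :\ v -> [/\ x \in E, v != x & #|N x| <= 4].
  rewrite in_setD1 => /andP[xv xO]; split; last by rewrite -d4E leOd.
    by move: xO; rewrite inE => /andP[].
  by rewrite eq_sym.
have [|uE vu du] := Ov u; first by rewrite Ouw !inE eqxx.
have [|wE vw dw] := Ov w; first by rewrite Ouw !inE eqxx orbT.
(* The two degrees are at most 4 and sum to at least 7, so one is 4 and the other at least 3. *)
have [u4|u3] := leqP 4 #|N u|.
  by exists v, u; split=> //; apply: (K24 u w) => //; lia.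
exists v, w; split=> //; apply: (K24 w u); rewrite ?Ouw 1?setUC //; lia.
Qed.

End TriangleFree.

(** * Edges in cyclic position without rainbow 3- and 4-cycles *)

Section Rainbow.
Variables (r : nat) (V : finType) (H : {set {set V}}) (part : V -> 'I_r).
Hypotheses (Hpart : partite_by H part) (Hlin : linear_hypergraph H).
Hypotheses (no3 : ~ has_rainbow_cycle H part 3).
Hypotheses (no4 : ~ has_rainbow_cycle H part 4).

Lemma part_inj A x y :
  A \in H -> x \in A -> y \in A -> part x = part y -> x = y.
Proof.
move=> AH xA yA pxy; have /eqP/cards1P[z Dz] := Hpart (part y) AH.
have : x \in [set z in A | part z == part y] by rewrite inE xA pxy eqxx.
have : y \in [set z in A | part z == part y] by rewrite inE yA eqxx.
by rewrite Dz !inE => /eqP-> /eqP.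
Qed.

Lemma linear_inj A B x y : A \in H -> B \in H -> A != B ->
  x \in A -> x \in B -> y \in A -> y \in B -> x = y.
Proof.
move=> AH BH AB xA xB yA yB; have /card_le1_eqP h := Hlin AH BH AB.
by apply: h; rewrite inE ?xA ?yA.
Qed.

(** If [x != y], linearity makes all three points distinct; any two of them share an edge, so their
    parts differ and the triangle is rainbow. *)
Lemma no_triangle A B C x y z : A \in H -> B \in H -> C \in H ->
  A != B -> B != C -> C != A ->
  x \in A -> x \in B -> y \in B -> y \in C -> z \in C -> z \in A -> x = y.
Proof.
move=> AH BH CH AB BC CA xA xB yB yC zC zA; apply/eqP; apply: contraT => xy.
have xz : x != z.
  apply: contraNneq xy => xz; apply/eqP.
  by apply: (linear_inj BH CH) => //; rewrite xz.
have yz : y != z.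
  apply: contraNneq xy => yz; apply/eqP.
  by apply: (linear_inj AH BH) => //; rewrite yz.
have pxy : part x != part y by apply: contraNneq xy => /(part_inj BH xB yB)->.
have pxz : part x != part z by apply: contraNneq xz => /(part_inj AH xA zA)->.
have pyz : part y != part z by apply: contraNneq yz => /(part_inj CH yC zC)->.
case: no3; exists (tnth [tuple x; y; z]), (tnth [tuple B; C; A]); split.
  split.
  - by apply/tuple_uniqP; rewrite /= !inE negb_or xy xz yz.
  - by apply/tuple_uniqP; rewrite /= !inE negb_or BC CA [B == A]eq_sym AB.
  - by case=> [[|[|[|//]]] i].
  - by case=> [[|[|[|//]]] i].
have : injective (tnth [tuple part x; part y; part z]).
  by apply/tuple_uniqP; rewrite /= !inE negb_or pxy pxz pyz.
by move=> inj [[|[|[|//]]] i] [[|[|[|//]]] j] h; apply: inj.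
Qed.

(** Consecutive points share an edge, so only a diagonal pair can agree in part, and one must, or
    the 4-cycle would be rainbow. *)
Lemma square_parts A X B Y p1 p2 p3 p4 :
    A \in H -> X \in H -> B \in H -> Y \in H -> uniq [:: A; X; B; Y] ->
    uniq [:: p1; p2; p3; p4] ->
    p1 \in A -> p1 \in X -> p2 \in X -> p2 \in B ->
    p3 \in B -> p3 \in Y -> p4 \in Y -> p4 \in A ->
  [/\ part p1 <> part p4, part p2 <> part p3
    & part p1 = part p3 \/ part p2 = part p4].
Proof.
move=> AH XH BH YH uA up p1A p1X p2X p2B p3B p3Y p4Y p4A.
have uA' : uniq [:: X; B; Y; A] by rewrite -(rot_uniq 1) in uA.
move: (up); rewrite /= !inE !negb_or => /and4P[/and3P[p12 p13 p14]].
move=> /andP[p23 p24] p34 _.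
have P12 : part p1 != part p2 by apply: contraNneq p12 => /(part_inj XH p1X p2X)->.
have P23 : part p2 != part p3 by apply: contraNneq p23 => /(part_inj BH p2B p3B)->.
have P34 : part p3 != part p4 by apply: contraNneq p34 => /(part_inj YH p3Y p4Y)->.
have P14 : part p1 != part p4 by apply: contraNneq p14 => /(part_inj AH p1A p4A)->.
split; [exact/eqP | exact/eqP |].
have [->|P13] := eqVneq (part p1) (part p3); first by left.
have [->|P24] := eqVneq (part p2) (part p4); first by right.
case: no4; exists (tnth [tuple p1; p2; p3; p4]), (tnth [tuple X; B; Y; A]); split.
  split.
  - exact/tuple_uniqP.
  - exact/tuple_uniqP.
  - by case=> [[|[|[|[|//]]]] i].
  - by case=> [[|[|[|[|//]]]] i].
have : injective (tnth [tuple part p1; part p2; part p3; part p4]).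
  by apply/tuple_uniqP; rewrite /= !inE !negb_or P12 P13 P14 P23 P24 P34.
by move=> inj [[|[|[|[|//]]]] i] [[|[|[|[|//]]]] j] h; apply: inj.
Qed.

(** * The graph of rooted adjacencies on a family of edges *)

Variable E : {set {set V}}.
Hypothesis EH : E \subset H.

Let root q : {set V} := odflt set0 [pick A in E | q \in A].

(** Each vertex contributes a star centred at its root instead of a clique: edges through one point
    then form no triangle, while a point on [d] edges still yields [d - 1] adjacencies. *)
Let adj : rel {set V} := fun A B => [&& A \in E, B \in E, A != B
  & [exists q in A :&: B, (root q == A) || (root q == B)]].

Lemma adjP A B : reflect
  [/\ A \in E, B \in E, A != B
    & exists q, [/\ q \in A, q \in B & root q = A \/ root q = B]]
  (adj A B).
Proof.
apply: (iffP and4P) => [[AE BE AB /existsP[q]]|[AE BE AB [q [qA qB h]]]].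
  rewrite inE => /andP[/andP[qA qB] h]; split=> //; exists q; split=> //.
  by case/orP: h => /eqP; [left|right].
split=> //; apply/existsP; exists q; rewrite inE qA qB /=.
by case: h => ->; rewrite eqxx ?orbT.
Qed.

Lemma adj_sym : symmetric adj.
Proof.
by move=> A B; apply/adjP/adjP=> -[AE BE AB [q [qA qB h]]];
  split=> //; rewrite 1?eq_sym //; exists q; split=> //; tauto.
Qed.

(** By [no_triangle] the three witnesses are one point, and its root would have to belong to each of
    the pairs [A B], [B C], [C A]. *)
Lemma adj_triangle A B C : adj A B -> adj B C -> adj C A -> False.
Proof.
move=> /adjP[AE BE AB [x [xA xB rx]]] /adjP[_ CE BC [y [yB yC ry]]].
move=> /adjP[_ _ CA [z [zC zA rz]]].
have [[AH BH] CH] := (subsetP EH _ AE, subsetP EH _ BE, subsetP EH _ CE).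
have xy := no_triangle AH BH CH AB BC CA xA xB yB yC zC zA.
have yz := no_triangle BH CH AH BC CA AB yB yC zC zA xA xB.
subst y z; move: AB BC CA => /eqP AB /eqP BC /eqP CA.
by case: rx; case: ry; case: rz; congruence.
Qed.

(** If [p = q], then [no_triangle] on [B], [A], [Y] puts this point on [Y] too. Its star would
    contain the path [Y A X B], whose three adjacencies have no common end. *)
Lemma adj_square_neq A X B Y p q : A != B -> X != Y ->
  adj A X -> adj X B -> adj B Y -> adj Y A ->
  p \in A -> p \in X -> q \in X -> q \in B -> p != q.
Proof.
move=> AB XY /adjP[AE XE AX [p' [pA pX rp]]] /adjP[_ BE XB [q' [qX qB rq]]].
move=> /adjP[_ YE BY [s [sB sY _]]] /adjP[_ _ YA [t [tY tA rt]]] p1 p2 q1 q2.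
have [AH BH] := (subsetP EH _ AE, subsetP EH _ BE).
have [XH YH] := (subsetP EH _ XE, subsetP EH _ YE).
have /= Ep := linear_inj AH XH AX p1 p2 pA pX.
have /= Eq := linear_inj XH BH XB q1 q2 qX qB.
subst p' q'; apply/eqP => pq; subst q.
have pt := no_triangle BH AH YH _ _ _ q2 p1 tA tY sY sB.
have {}pt : p = t by apply: pt; rewrite eq_sym.
subst t; move: AB XY AX XB YA => /eqP AB /eqP XY /eqP AX /eqP XB /eqP YA.
by case: rp; case: rq; case: rt; congruence.
Qed.

Lemma adj_square A B X Y a b c d : A != B -> X != Y ->
  adj A X -> adj X B -> adj B Y -> adj Y A ->
  a \in A :&: X -> b \in B :&: X -> c \in A :&: Y -> d \in B :&: Y ->
  [/\ part a <> part c, part b <> part d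
    & part a = part d \/ part b = part c].
Proof.
move=> AB XY AX XB BY YA /setIP[aA aX] /setIP[bB bX] /setIP[cA cY] /setIP[dB dY].
have [BA YX] : B != A /\ Y != X by rewrite eq_sym AB eq_sym XY.
(* The four rotations of the square separate consecutive corners; linearity separates the diagonal
   ones below. *)
have ab := adj_square_neq AB XY AX XB BY YA aA aX bX bB.
have bd := adj_square_neq XY BA XB BY YA AX bX bB dB dY.
have dc := adj_square_neq BA YX BY YA AX XB dB dY cY cA.
have ca := adj_square_neq YX AB YA AX XB BY cY cA aA aX.
move: AX XB BY YA => /adjP[AE XE AX _] /adjP[_ BE XB _] /adjP[_ YE BY _].
move=> /adjP[_ _ YA _].
have [AH BH] := (subsetP EH _ AE, subsetP EH _ BE).
have [XH YH] := (subsetP EH _ XE, subsetP EH _ YE).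
apply: (square_parts AH XH BH YH) => //.
  by rewrite /= !inE !negb_or AX AB [A == Y]eq_sym YA XB XY BY.
have ad : a != d.
  apply: contraNneq ab => ad.
  by apply/eqP/(linear_inj XH BH XB) => //; rewrite ad.
have bc : b != c.
  apply: contraNneq ab => bc; apply/eqP.
  by apply: (linear_inj AH XH AX) => //; rewrite bc.
by rewrite /= !inE !negb_or ab ad [a == c]eq_sym ca bd bc dc.
Qed.

Lemma adj_K24_free A B : A != B ->
  #|[set X | adj A X] :&: [set X | adj B X]| < 4.
Proof.
move=> AB; rewrite ltnNge; apply/negP.
set S := _ :&: _; rewrite cardE => cS.
have uS := enum_uniq S; have mS X : X \in enum S -> adj A X /\ adj B X.
  by rewrite mem_enum !inE => /andP[].
case: (enum S) cS uS mS => [|X1 [|X2 [|X3 [|X4 s]]]] //= _ + mS.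
rewrite !inE !negb_or => /and5P[/and4P[n12 n13 n14 _] /and3P[n23 n24 _] /andP[n34 _] _ _].
have pts X : X \in [:: X1, X2, X3, X4 & s] ->
    [/\ adj A X, adj B X & exists a b, a \in A :&: X /\ b \in B :&: X].
  move=> /mS[AX BX]; split=> //.
  have [/adjP[_ _ _ [a [aA aX _]]] /adjP[_ _ _ [b [bB bX _]]]] := (AX, BX).
  by exists a, b; rewrite !inE aA aX bB bX.
have [|A1 B1 [a1 [b1 [m1 k1]]]] := pts X1; first by rewrite !inE eqxx.
have [|A2 B2 [a2 [b2 [m2 k2]]]] := pts X2; first by rewrite !inE eqxx ?orbT.
have [|A3 B3 [a3 [b3 [m3 k3]]]] := pts X3; first by rewrite !inE eqxx ?orbT.
have [|A4 B4 [a4 [b4 [m4 k4]]]] := pts X4; first by rewrite !inE eqxx ?orbT.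
have sq X Y a b c d : X != Y -> adj A X -> adj B X -> adj A Y -> adj B Y ->
    a \in A :&: X -> b \in B :&: X -> c \in A :&: Y -> d \in B :&: Y ->
    [/\ part a <> part c, part b <> part d
      & part a = part d \/ part b = part c].
  move=> XY AX BX AY BY.
  by apply: adj_square; rewrite // adj_sym.
have [a12 b12 h12] := sq _ _ _ _ _ _ n12 A1 B1 A2 B2 m1 k1 m2 k2.
have [a13 b13 h13] := sq _ _ _ _ _ _ n13 A1 B1 A3 B3 m1 k1 m3 k3.
have [a14 b14 h14] := sq _ _ _ _ _ _ n14 A1 B1 A4 B4 m1 k1 m4 k4.
have [a23 b23 h23] := sq _ _ _ _ _ _ n23 A2 B2 A3 B3 m2 k2 m3 k3.
have [a24 b24 h24] := sq _ _ _ _ _ _ n24 A2 B2 A4 B4 m2 k2 m4 k4.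
have [a34 b34 h34] := sq _ _ _ _ _ _ n34 A3 B3 A4 B4 m3 k3 m4 k4.
(* Each of the six pairs [i < j] gives a coincidence of parts between [a_i] and [b_j] or between
   [a_j] and [b_i]. The [b]'s lie in distinct parts, so each [a] occurs at most once: at most four
   coincidences. *)
clear -a12 a13 a14 a23 a24 a34 b12 b13 b14 b23 b24 b34 h12 h13 h14 h23 h24 h34.
by case: h12; case: h13; case: h14; case: h23; case: h24; case: h34; congruence.
Qed.

(** * Counting adjacencies *)

Lemma rootP A q : A \in E -> q \in A -> root q \in E /\ q \in root q.
Proof.
move=> AE qA; rewrite /root; case: pickP => [B /andP[] //|/(_ A)].
by rewrite AE qA.
Qed.

(** Among the [#|E| * r'] incidences, at most one per covered vertex joins it to its root. Every
    other incidence gives an adjacency in both orders ([f] and [g]), and linearity prevents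
    repetitions. *)
Lemma sum_adj_ge (r' : nat) : uniform H r' ->
  2 * (#|E| * r' - #|cover E|) <= \sum_(A in E) #|[set B | adj A B]|.
Proof.
move=> Hr.
pose Q := [set z : {set V} * V | (z.1 \in E) && (z.2 \in z.1)].
pose P := [set z in Q | root z.2 != z.1].
have cQ : #|Q| = #|E| * r'.
  rewrite /Q (card_dep_pairs _ (fun A : {set V} => mem A)) -sum_nat_const.
  by apply: eq_bigr => A /(subsetP EH)/Hr.
have cP : #|E| * r' - #|cover E| <= #|P|.
  rewrite -cQ leq_subLR -(cardsID [set z | root z.2 == z.1] Q) leq_add //.
    apply: leq_trans (leq_imset_card (fun q => (root q, q)) (cover E)).
    apply: subset_leq_card; apply/subsetP => -[A q]; rewrite !inE /=.
    move=> /andP[/andP[AE qA] /eqP rq]; apply/imsetP; exists q; last by rewrite rq.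
    by apply/bigcupP; exists A.
  apply: subset_leq_card; apply/subsetP => -[A q]; rewrite !inE /=.
  by move=> /andP[-> ->].
pose f (z : {set V} * V) := (root z.2, z.1).
pose g (z : {set V} * V) := (z.1, root z.2).
have Pprop z : z \in P -> [/\ z.1 \in E, z.2 \in z.1, root z.2 \in E,
    z.2 \in root z.2 & root z.2 != z.1].
  rewrite !inE => /andP[/andP[zE zz] rz].
  by have [? ?] := rootP zE zz; split.
have injP A B q s : A \in E -> B \in E -> A != B ->
    q \in A -> q \in B -> s \in A -> s \in B -> q = s.
  by move=> /(subsetP EH) AH /(subsetP EH) BH; apply: linear_inj.
have f_inj : {in P &, injective f}.
  move=> [A q] [B s] /Pprop/= [AE qA rE qr ra] /Pprop/= [BE sB _ sr _].
  rewrite /f /= => -[rr AB]; subst B; congr (_, _).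
  by apply: (injP _ _ _ _ rE AE ra) => //; rewrite rr.
have g_inj : {in P &, injective g}.
  by move=> x y xP yP [h1 h2]; apply: f_inj; rewrite // /f h1 h2.
(* A common value would come from two points on the same two edges, hence from one point with two
   different roots. *)
have fg0 : f @: P :&: g @: P = set0.
  apply/eqP; rewrite -subset0; apply/subsetP => z /setIP[/imsetP[[A q] zP ->]].
  move=> /imsetP[[B s] sP []] /= rB As.
  have /= [AE qA rE qr ra] := Pprop _ zP; have /= [BE sB _ sr rb] := Pprop _ sP.
  rewrite As in qA ra; rewrite rB in qr ra; rewrite As in AE.
  have qs := injP _ _ _ _ BE AE ra qr qA sB sr.
  by subst s; rewrite rB eqxx in ra.
have sub : f @: P :|: g @: P \subset
    [set z | (z.1 \in E) && adj z.1 z.2].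
  rewrite subUset; apply/andP; split.
    apply/subsetP => _ /imsetP[z /Pprop[zE zz rE rz rn] ->]; rewrite inE /= rE /=.
    by apply/adjP; split=> //; exists z.2; split=> //; left.
  apply/subsetP => _ /imsetP[z /Pprop[zE zz rE rz rn] ->]; rewrite inE /= zE /=.
  by rewrite adj_sym; apply/adjP; split=> //; exists z.2; split=> //; left.
have := subset_leq_card sub.
rewrite (card_dep_pairs _ adj) cardsU fg0 cards0 subn0 !card_in_imset //.
rewrite addnn -mul2n => le; apply: (leq_trans (n := 2 * #|P|)).
  by rewrite leq_mul2l.
by apply: leq_trans le _; apply: leq_sum => A _; rewrite cardsE.
Qed.

(** Otherwise at least 11 incidences are not at roots, so the degree sum reaches the 22 that forces
    a [K_{2,4}]. *)
Lemma seven_edges_cover (r' : nat) : uniform H r' -> #|E| = 7 ->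
  7 * r' < #|cover E| + 11.
Proof.
move=> Hr E7; rewrite ltnNge; apply/negP => small.
have := sum_adj_ge Hr; rewrite E7 => le.
have [||A|||A [B [_ _ AB]]] := @triangle_free7_K24 _ E adj E7.
- by move=> A B /adjP[].
- exact: adj_sym.
- by apply/negP => /adjP[_ _ /eqP].
- exact: adj_triangle.
- by apply: leq_trans le; lia.
by rewrite leqNgt adj_K24_free.
Qed.

End Rainbow.

Theorem theorem15 (r : nat) (V : finType) (H : {set {set V}})
    (part : V -> 'I_r) :
  3 <= r ->
  uniform H r ->
  partite_by H part ->
  linear_hypergraph H ->
  ~ has_rainbow_cycle H part 3 ->
  ~ has_rainbow_cycle H part 4 ->
  G_free H (7 * r - 11) 7.
Proof.
move=> r3 Hr Hp Hl h3 h4 E EH E7.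
(* With [3 <= r] the truncated subtraction [7 * r - 11] is exact. *)
have := seven_edges_cover Hp Hl h3 h4 EH Hr E7; lia.
Qed.
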